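(* Let $X$ be a complex Hilbert space with open unit ball $B$, let $0\le\alpha<1$, and let $f:B\to X$, $f(z)=z+\sum_{k=2}^{\infty}A_k(z^k)$, be a holomorphic mapping. If $$\sum_{k=2}^{\infty}k(k-\alpha)\|A_k\|\le 1-\alpha,$$ then $f\in K(B,\alpha)$.
   Context: $X$ is a complex Hilbert space with inner product $\langle\cdot,\cdot\rangle$ and norm $\|\cdot\|$, and $B=\{z\in X:\|z\|<1\}$. $Df(z)$ and $D^kf(z)$ denote the first and $k$-th Fréchet derivatives of a holomorphic mapping $f$ at $z$. In the expansion of $f$, $A_k=\frac1{k!}D^kf(0)$ is a bounded symmetric $k$-linear operator $X\times\cdots\times X\to X$, $A_k(z^k)=A_k(z,\dots,z)$, and $\|A_k\|$ is its norm as a bounded $k$-linear operator. A holomorphic mapping $f:B\to X$ is locally biholomorphic if every point of $B$ has a neighborhood on which $f$ is biholomorphic (onto its image, with holomorphic inverse); equivalently, $Df(z)$ has a bounded inverse at each $z\in B$. For $0\le\alpha<1$, a locally biholomorphic mapping $f:B\to X$ is called a biholomorphic convex mapping of order $\alpha$ on $B$ if $$\|x\|^2-\mathrm{Re}\,\big\langle Df(z)^{-1}D^2f(z)(x,x),z\big\rangle>\alpha\|x\|^2$$ for all $z\in B\setminus\{0\}$ and $x\in X\setminus\{0\}$ with $\mathrm{Re}\,\langle x,z\rangle=0$. $K(B,\alpha)$ is the class of all biholomorphic convex mappings $f$ of order $\alpha$ on $B$ with $f(0)=0$ and $Df(0)=I$, where $I$ is the identity operator on $X$. *)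

(* Defs.v *)
From HB Require Import structures.
From mathcomp Require Import all_boot all_order all_fingroup all_algebra.
From mathcomp Require Import all_classical all_reals all_analysis.
From mathcomp Require Import complex.

Set Implicit Arguments.
Unset Strict Implicit.
Unset Printing Implicit Defensive.

Import Order.TTheory GRing.Theory Num.Theory.
Import numFieldNormedType.Exports.

Local Open Scope classical_set_scope.
Local Open Scope ring_scope.
Local Open Scope complex_scope.

Section Multilinear.
Context {R : realType} {X : normedModType R[i]}.

(* The norm of a normedModType R[i] has values in R[i], on the nonnegative real
   axis; rnorm is the same norm with values in R. *)
Definition rnorm (x : X) : R := complex.Re `|x|.

Definition multilinear k (M : ('I_k -> X) -> X) : Prop :=
  forall (i : 'I_k) (v : 'I_k -> X), linear (fun x => M [eta v with i |-> x]).

Definition bounded_multilinear k (M : ('I_k -> X) -> X) : Prop :=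
  multilinear M /\
  exists c : R, forall v, `|M v| <= c%:C * \prod_(i < k) `|v i|.

Definition symmetric_multilinear k (M : ('I_k -> X) -> X) : Prop :=
  forall (s : 'S_k) (v : 'I_k -> X), M (v \o s) = M v.

Definition mnorm k (M : ('I_k -> X) -> X) : \bar R :=
  ereal_sup [set (rnorm (M v))%:E | v in [set v | forall i, `|v i| <= 1]].

Definition vcons k (h : X) (v : 'I_k -> X) : 'I_k.+1 -> X :=
  fun i => oapp v h (unlift ord0 i).

(* T is the Frechet derivative at z of F : X -> L^k(X; X), for the norm of
   bounded k-linear operators, with the usual identification
   L(X, L^k(X; X)) = L^k.+1(X; X): (DF(z) h)(v) = T (h, v). *)
Definition is_fderiv k (F : X -> ('I_k -> X) -> X) (z : X)
    (T : ('I_k.+1 -> X) -> X) : Prop :=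
  bounded_multilinear T /\
  forall e : R, 0 < e -> \forall h \near (0 : X), forall v : 'I_k -> X,
    `|F (z + h) v - F z v - T (vcons h v)|
      <= e%:C * `|h| * \prod_(i < k) `|v i|.

(* fderivn k f z = D^k f(z); the value is the junk 0 where it does not exist. *)
Fixpoint fderivn k (f : X -> X) : X -> ('I_k -> X) -> X :=
  match k with
  | 0 => fun z _ => f z
  | k'.+1 => fun z => xget (fun=> 0) [set T | is_fderiv (@fderivn k' f) z T]
  end.
Arguments fderivn : clear implicits.

Lemma vconsK k (w : 'I_k.+1 -> X) :
  vcons (w ord0) (fun i => w (lift ord0 i)) = w.
Proof.
by apply/funext => i; rewrite /vcons; case: unliftP => [j ->|->].
Qed.

Lemma rnormE (x : X) : `|x| = (rnorm x)%:C.
Proof. by rewrite /rnorm RRe_real // normr_real. Qed.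

Lemma vcons_linear k (T : ('I_k.+1 -> X) -> X) (v : 'I_k -> X) :
  multilinear T -> linear (fun h => T (vcons h v)).
Proof.
move=> Tlin.
have -> : (fun h => T (vcons h v)) =
          (fun h => T [eta vcons 0 v with ord0 |-> h]).
  apply/funext => h; congr T; apply/funext => i; rewrite /= /vcons.
  by case: unliftP => [j ->|->] /=; rewrite ?eqxx // eq_liftF.
exact: Tlin.
Qed.

Lemma is_fderiv_unique k (F : X -> ('I_k -> X) -> X) z T1 T2 :
  is_fderiv F z T1 -> is_fderiv F z T2 -> T1 = T2.
Proof.
move=> [[l1 _] d1] [[l2 _] d2]; apply/funext => w; rewrite -(vconsK w).
move: (w ord0) (fun i => w (lift ord0 i)) => h v {w}.
pose L x := T1 (vcons x v) - T2 (vcons x v).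
have LZ (a : R[i]) x : L (a *: x) = a *: L x.
  have lin (T : ('I_k.+1 -> X) -> X) : multilinear T ->
      T (vcons (a *: x) v) = a *: T (vcons x v).
    move=> /(@vcons_linear _ _ v) lT.
    have := lT 1 0 0; rewrite scaler0 add0r scale1r => T0.
    have {}T0 : T (vcons 0 v) = 0.
      by apply: (@addrI _ (T (vcons 0 v))); rewrite addr0 -T0.
    by have := lT a x 0; rewrite addr0 T0 addr0.
  by rewrite /L !lin // scalerBr.
suff : L h = 0 by move/eqP; rewrite subr_eq0 => /eqP.
apply/normr0_eq0; pose P := \prod_(i < k) `|v i|.
have P0 : 0 <= P by apply: prodr_ge0 => i _; exact: normr_ge0.
have key (e : R) : 0 < e -> `|L h| <= (e + e)%:C * `|h| * P.
  move=> e0.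
  have /nbhs_ballP[r /= r0 Hr] : nbhs (0 : X) (fun x : X =>
      `|L x| <= (e + e)%:C * `|x| * P).
    near=> x.
    have B1 : `|F (z + x) v - F z v - T1 (vcons x v)| <= e%:C * `|x| * P.
      by near: x; apply: filterS (d1 e e0) => x; apply.
    have B2 : `|F (z + x) v - F z v - T2 (vcons x v)| <= e%:C * `|x| * P.
      by near: x; apply: filterS (d2 e e0) => x; apply.
    have -> : L x = (F (z + x) v - F z v - T2 (vcons x v))
                    - (F (z + x) v - F z v - T1 (vcons x v)).
      rewrite /L opprB [RHS]addrC addrA subrK //.
    rewrite rmorphD !mulrDl; apply: le_trans (ler_normB _ _) _.
    exact: lerD.
  pose t : R[i] := r / 2 / (`|h| + 1).
  have h1 : 0 < `|h| + 1 by rewrite ltr_wpDl.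
  have t0 : 0 < t by rewrite !divr_gt0.
  have /Hr : ball (0 : X) r (t *: h).
    rewrite -ball_normE /ball_ /= sub0r normrN normrZ gtr0_norm //.
    apply: (@le_lt_trans _ _ (r / 2)); last first.
      by rewrite ltr_pdivrMr // ltr_pMr // ltr1n.
    rewrite /t mulrAC ler_pdivrMr // ler_wpM2l ?lerDl //.
    by rewrite ltW // divr_gt0.
  rewrite LZ !normrZ gtr0_norm // => H.
  rewrite -(ler_pM2l t0) (le_trans H) // !(mulrA t) (mulrC t _%:C).
  by rewrite !(mulrA _ t).
have hP : 0 <= `|h| * P by rewrite mulr_ge0.
have [Q QE] : exists Q : R, `|h| * P = Q%:C.
  by exists (complex.Re (`|h| * P)); rewrite RRe_real // ger0_real.
move: hP; rewrite QE lecR => Q0; apply/eqP; rewrite eq_le normr_ge0 andbT.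
rewrite rnormE lecR; apply/ler_addgt0Pr => d d0; rewrite add0r.
have c0 : 0 < Q + 1 by rewrite ltr_wpDl.
have := key (d / (Q + 1) / 2).
rewrite -splitr -(mulrA _ `|h|) QE -rmorphM rnormE lecR !divr_gt0 // => /(_ isT).
by move/le_trans; apply; rewrite mulrAC ler_pdivrMr // ler_pM2l // lerDl.
Unshelve. all: by end_near. Qed.

(* The first iterate is the library differential. *)
Lemma fderivn1 (f : X -> X) (z : X) (v : 'I_1 -> X) :
  differentiable f z -> fderivn 1 f z v = 'd f z (v ord0).
Proof.
move=> df; pose T (w : 'I_1 -> X) := 'd f z (w ord0).
have HT : is_fderiv (fderivn 0 f) z T.
  split.
    split; first by move=> i v0 a u w; rewrite /T /= (ord1 i) eqxx linearP.
    have /linear_boundedP : bounded_near ('d f z) (nbhs (0 : X)).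
      exact/linear_bounded_continuous/diff_continuous.
    move=> [M [Mr HM]].
    exists (complex.Re M + 1) => v0; rewrite big_ord1 /T; apply: HM.
    by rewrite rmorphD /= RRe_real // ltrDl ltr01.
  move=> e e0; have /diff_locallyxP[_ fz] := df.
  have e0' : 0 < e%:C :> R[i] by rewrite ltcR.
  have /eqaddoP lo : f \o shift z = (cst (f z) + 'd f z : X -> X) +o_ (0 : X) id.
    exact/funext.
  apply: filterS (lo _ e0') => h fh u; rewrite big_ord0 mulr1.
  rewrite /= /T /vcons unlift_none /= (addrC z).
  by move: fh; rewrite /= /cst /shift /= opprD addrA.
rewrite /= ; set F1 := xget _ _.
have HF1 : is_fderiv (fderivn 0 f) z F1 by apply: xgetPex; exists T.
by rewrite (is_fderiv_unique HF1 HT).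
Qed.

End Multilinear.

Arguments fderivn {R X} k f z v.

Section Holomorphic.
Context {R : realType} {X : normedModType R[i]}.

Definition unit_ball : set X := [set z | `|z| < 1].

(* Complex Frechet differentiability at every point; only used for U open. *)
Definition holomorphic (U : set X) (f : X -> X) : Prop :=
  forall z, U z -> differentiable f z.

Definition biholomorphic_on (U : set X) (f : X -> X) : Prop :=
  [/\ open U, holomorphic U f, open (f @` U) &
      exists2 g : X -> X, holomorphic (f @` U) g & forall w, U w -> g (f w) = w].

Definition locally_biholomorphic (B : set X) (f : X -> X) : Prop :=
  forall z, B z -> exists U : set X, [/\ U z, U `<=` B & biholomorphic_on U f].

(* Df(z)^-1; a genuine inverse as soon as 'd f z is bijective, which holds for
   z in the ball when f is locally biholomorphic there. *)
Definition diff_inv (f : X -> X) (z : X) : X -> X :=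
  'pinv_(fun=> 0) setT ('d f z).

End Holomorphic.

Section ConvexClass.
Context {R : realType} {X : completeNormedModType R[i]}.

(* {dot X for Num.conj} is linear in its first argument, conjugate-linear in
   its second one. *)
Definition is_hilbert (ip : {dot X for Num.conj}) : Prop :=
  forall x, `|x| ^+ 2 = ip x x.

Definition convex_of_order (ip : {dot X for Num.conj}) (alpha : R)
    (f : X -> X) : Prop :=
  locally_biholomorphic unit_ball f /\
  forall z x : X, unit_ball z -> z != 0 -> x != 0 -> complex.Re (ip x z) = 0 ->
    alpha * rnorm x ^+ 2 <
      rnorm x ^+ 2
      - complex.Re (ip (diff_inv f z (fderivn 2 f z (fun=> x))) z).

Definition convex_class (ip : {dot X for Num.conj}) (alpha : R)
    (f : X -> X) : Prop :=
  [/\ holomorphic unit_ball f, convex_of_order ip alpha f,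
      f 0 = 0 & forall x, 'd f 0 x = x].

End ConvexClass.

(* Main.v *)
Require Import Defs.
From HB Require Import structures.
From mathcomp Require Import all_boot all_order all_fingroup all_algebra.
From mathcomp Require Import all_classical all_reals all_analysis.
From mathcomp Require Import complex ring lra.

Set Implicit Arguments.
Unset Strict Implicit.
Unset Printing Implicit Defensive.

Import Order.TTheory GRing.Theory Num.Theory.
Import numFieldNormedType.Exports.

Local Open Scope classical_set_scope.
Local Open Scope ring_scope.
Local Open Scope complex_scope.

(** Write [f = id + h] with [h z = sum_k A_k (z^k)], let [m_k] be the norm of
    [A_k] and [Q = sum_k k m_k], [S = sum_k k (k - 1) m_k].  From
    [k (k - alpha) = k (k - 1) + (1 - alpha) k] the hypothesis says
    [S <= (1 - alpha) (1 - Q)], and [k (k - alpha) >= (2 - alpha) k] makes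
    [Q < 1] ([coef_bounds]).  Both numbers control [f] on the whole ball:

    - [h] is [Q]-Lipschitz, hence [norm (Df(z) - I) <= Q] and [Df(z)] is
      invertible with [norm (Df(z)^-1) <= 1 / (1 - Q)] ([diff_inv_le]);
    - [Df] is [S]-Lipschitz, hence [norm (D^2f(z)) <= S] ([fderivn2_le]).

    The Cauchy-Schwarz inequality then gives
    [Re <Df(z)^-1 D^2f(z)(x, x), z> <= norm z * S / (1 - Q) * norm x ^ 2],
    which is less than [(1 - alpha) norm x ^ 2] because [norm z < 1].

    The bounds on the derivatives are not obtained by differentiating the
    series termwise.  The first and second differences of each homogeneous
    term [A_k (z^k)] are estimated by multilinearity ([diagonal_lipschitz],
    [diagonal_diff2]); such estimates survive summation and pointwise limits,
    and an estimate on increments of a differentiable map bounds its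
    differential ([homogeneous_bound]).

    Local biholomorphy holds in the strong form that [f] is biholomorphic on
    the ball itself.  A map [id + h] with [h] a contraction is injective and,
    by the fixed point argument of [perturbation_onto], maps every closed ball
    of radius [r] in its domain onto a set containing the closed ball of radius
    [(1 - Q) r] around the image of the centre.  The
    same lemma applied to the linear map [Df(z)] yields the surjectivity of
    [Df(z)]. *)

(** * The real-valued norm *)

Lemma subrACA (V : zmodType) (a b c d : V) : a - b - (c - d) = a - c - (b - d).
Proof. by rewrite opprD addrACA -opprD. Qed.

Section RealNorm.
Context {R : realType} {X : normedModType R[i]}.
Implicit Types x y z : X.

Lemma le_rnorm x (c : R) : (`|x| <= c%:C) = (rnorm x <= c).
Proof. by rewrite rnormE lecR. Qed.

Lemma lt_rnorm x (c : R) : (`|x| < c%:C) = (rnorm x < c).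
Proof. by rewrite rnormE ltcR. Qed.

Lemma rnorm_ge0 x : 0 <= rnorm x.
Proof. by rewrite -(@lecR R) -rnormE normr_ge0. Qed.

Lemma rnorm0 : rnorm (0 : X) = 0.
Proof. by rewrite /rnorm normr0. Qed.

Lemma rnormN x : rnorm (- x) = rnorm x.
Proof. by rewrite /rnorm normrN. Qed.

Lemma rdistC x y : rnorm (x - y) = rnorm (y - x).
Proof. by rewrite /rnorm distrC. Qed.

Lemma ler_rnormD x y : rnorm (x + y) <= rnorm x + rnorm y.
Proof. by rewrite -le_rnorm rmorphD /= -!rnormE ler_normD. Qed.

Lemma ler_rnormB x y : rnorm (x - y) <= rnorm x + rnorm y.
Proof. by rewrite -(rnormN y) ler_rnormD. Qed.

Lemma ler_rdistD z x y : rnorm (x - y) <= rnorm (x - z) + rnorm (z - y).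
Proof. by rewrite -le_rnorm rmorphD /= -!rnormE ler_distD. Qed.

Lemma rnormZ (a : R[i]) x : rnorm (a *: x) = complex.Re `|a| * rnorm x.
Proof.
apply: (@complexI R); rewrite -rnormE normrZ rmorphM /= -rnormE; congr (_ * _).
Qed.

Lemma rnormZR (a : R) x : rnorm (a%:C *: x) = `|a| * rnorm x.
Proof. by rewrite rnormZ normc_def /= expr0n addr0 sqrtr_sqr. Qed.

Lemma rnorm_eq0 x : (rnorm x == 0) = (x == 0).
Proof. by rewrite -[RHS]normr_eq0 rnormE -(inj_eq (@complexI R)). Qed.

Lemma rnorm_gt0 x : (0 < rnorm x) = (x != 0).
Proof. by rewrite lt0r rnorm_ge0 andbT rnorm_eq0. Qed.

Lemma rnorm_sum I (r : seq I) (F : I -> X) :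
  rnorm (\sum_(i <- r) F i) <= \sum_(i <- r) rnorm (F i).
Proof.
elim/big_ind2 : _ => [|a b c d ab cd|//]; first by rewrite rnorm0.
by rewrite (le_trans (ler_rnormD _ _)) // lerD.
Qed.

Lemma unit_ballE z : unit_ball z = (rnorm z < 1) :> Prop.
Proof. by rewrite -lt_rnorm. Qed.

Lemma nbhs_rnormP z (P : set X) :
  nbhs z P <-> exists2 r : R, 0 < r & forall y, rnorm (y - z) < r -> P y.
Proof.
split=> [/nbhs_ballP[r /= r0 rP]|[r r0 rP]].
  have rE : r = (complex.Re r)%:C by rewrite RRe_real // ger0_real // ltW.
  exists (complex.Re r); first by rewrite -(@ltcR R) -rE.
  move=> y yr; apply: rP; rewrite -ball_normE /ball_ /= distrC rE.
  by rewrite rnormE ltcR.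
apply/nbhs_ballP; exists r%:C; first by rewrite /= ltcR.
by move=> y; rewrite -ball_normE /ball_ /= distrC lt_rnorm => /rP.
Qed.

Lemma nbhs0_rnormP (P : set X) :
  nbhs (0 : X) P <-> exists2 r : R, 0 < r & forall y, rnorm y < r -> P y.
Proof.
split=> [/nbhs_rnormP|] [r r0 rP]; first exists r => // y.
  by rewrite -[y in rnorm y]subr0; exact: rP.
by apply/nbhs_rnormP; exists r => // y; rewrite subr0; exact: rP.
Qed.

(** A bound that is only asymptotic at the origin is exact for a homogeneous
    map, by rescaling.  This is how estimates on increments of a map pass to
    its differential: there [e] absorbs the error of the linear
    approximation. *)
Lemma homogeneous_bound (L : X -> X) (c : R) :
  (forall (t : R) h, L (t%:C *: h) = t%:C *: L h) ->
  (forall e : R, 0 < e ->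
     \forall h \near (0 : X), rnorm (L h) <= (c + e) * rnorm h) ->
  forall h, rnorm (L h) <= c * rnorm h.
Proof.
move=> LZ Lc h.
have L0 : L 0 = 0 by have := LZ 0 0; rewrite scaler0 scale0r.
have [->|h0] := eqVneq h 0; first by rewrite L0 rnorm0 mulr0.
have {}h0 : 0 < rnorm h by rewrite rnorm_gt0.
rewrite -ler_pdivrMr //; apply/ler_addgt0Pr => e e0.
have /nbhs0_rnormP[r r0 Lr] := Lc e e0.
pose t := r / 2 / rnorm h.
have t0 : 0 < t by rewrite !divr_gt0.
have := Lr (t%:C *: h); rewrite LZ !rnormZR gtr0_norm // ler_pdivrMr //.
rewrite mulrCA ler_pM2l //; apply.
by rewrite /t divfK ?gt_eqF // ltr_pdivrMr // ltr_pMr // ltr1n.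
Qed.

End RealNorm.

(** * Differences of bounded multilinear maps *)

Section MultilinearBounds.
Context {R : realType} {X : normedModType R[i]}.
Variables (k : nat) (M : ('I_k -> X) -> X).
Implicit Types (v w : 'I_k -> X).

Definition opnorm : R := fine (mnorm M).

Lemma mnorm_ge0 : (0 <= mnorm M)%E.
Proof.
apply: (@le_trans _ _ (rnorm (M (fun=> 0)))%:E).
  by rewrite lee_fin rnorm_ge0.
by apply: ereal_sup_ubound; exists (fun=> 0) => //= i; rewrite normr0.
Qed.

Lemma opnorm_ge0 : 0 <= opnorm.
Proof. by rewrite fine_ge0 // mnorm_ge0. Qed.

(** The scalars are pulled out one coordinate at a time, along a list of
    coordinates that have already been treated. *)
Lemma multilinear_scale (l : 'I_k -> R[i]) v : multilinear M ->
  M (fun i => l i *: v i) = (\prod_i l i) *: M v.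
Proof.
move=> Mlin.
suff key (s : seq 'I_k) : uniq s ->
    M (fun i => if i \in s then l i *: v i else v i)
      = (\prod_(i <- s) l i) *: M v.
  rewrite -key ?index_enum_uniq //; congr M.
  by apply/funext => i; rewrite mem_index_enum.
elim: s => [_|i s IH /= /andP[si us]]; first by rewrite big_nil scale1r.
rewrite big_cons -scalerA -IH //.
set w := (X in _ = _ *: M X).
have MZ (a : R[i]) x :
    M [eta w with i |-> a *: x] = a *: M [eta w with i |-> x].
  have := Mlin i w a x 0; have := Mlin i w 1 0 0.
  rewrite scaler0 addr0 scale1r => E.
  have -> : M [eta w with i |-> 0] = 0.
    by apply: (@addrI _ (M [eta w with i |-> 0])); rewrite addr0 -E.
  by rewrite !addr0.
have -> : w = [eta w with i |-> v i].
  by apply/funext => j /=; case: eqP => // ->; rewrite /w (negPf si).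
rewrite -MZ; congr M; apply/funext => j /=; rewrite inE /w.
by case: eqP => // ->.
Qed.

Hypothesis Mbd : bounded_multilinear M.

(** A bounded multilinear map has a finite norm, so that [opnorm] is not the
    default value of [fine]. *)
Lemma mnormE : mnorm M = opnorm%:E.
Proof.
have [Mlin [c Mc]] := Mbd.
rewrite /opnorm fineK // ge0_fin_numE ?mnorm_ge0 //.
apply: (@le_lt_trans _ _ (`|c|)%:E); last exact: ltry.
apply: ge_ereal_sup => _ [v /= v1 <-]; rewrite lee_fin -le_rnorm.
apply: le_trans (Mc v) _.
have p0 : 0 <= \prod_(i < k) `|v i| by apply: prodr_ge0 => i _.
have p1 : \prod_(i < k) `|v i| <= 1 
  by apply: Num.Theory.prodr_ile1 => i _; rewrite normr_ge0 v1.
apply: (@le_trans _ _ (`|c|%:C * \prod_(i < k) `|v i|)).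
  by rewrite ler_wpM2r // lecR ler_norm.
by rewrite ler_piMr // lecR.
Qed.

(** Normalising every argument reduces to the unit vectors over which the
    supremum [mnorm] is taken; a zero argument normalises to zero. *)
Lemma le_opnorm v : rnorm (M v) <= opnorm * \prod_i rnorm (v i).
Proof.
have [Mlin _] := Mbd.
pose u i := (rnorm (v i))^-1%:C *: v i.
have uv : v = (fun i => (rnorm (v i))%:C *: u i).
  apply/funext => i; rewrite scalerA -rmorphM /=.
  have [->|vi0] := eqVneq (v i) 0; first by rewrite scaler0.
  by rewrite mulfV ?rnorm_eq0 // scale1r.
rewrite {1}uv multilinear_scale // -rmorph_prod rnormZR ger0_norm; last first.
  by apply: prodr_ge0 => i _; exact: rnorm_ge0.
rewrite mulrC ler_wpM2r //; first by apply: prodr_ge0 => i _; exact: rnorm_ge0.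
rewrite -lee_fin -mnormE; apply: ereal_sup_ubound; exists u => //= i.
rewrite rnormE (_ : 1 = 1%:C) // lecR rnormZR ger0_norm ?invr_ge0 ?rnorm_ge0 //.
have [->|vi0] := eqVneq (v i) 0; first by rewrite rnorm0 mulr0.
by rewrite mulVf ?rnorm_eq0.
Qed.

(** The arguments of the [i]-th term of the telescoping sum that exchanges [w]
    for [v] one coordinate at a time, from left to right. *)
Definition gap (i : 'I_k) v w : 'I_k -> X :=
  fun j => if (j < i)%N then v j else if j == i then v j - w j else w j.

(** [M v - M w] is the sum of the increments between consecutive hybrids
    [S n], which agree with [v] before [n] and with [w] from [n] on. *)
Lemma multilinear_telescope v w : M v - M w = \sum_i M (gap i v w).
Proof.
have [Mlin _] := Mbd.
pose S n : 'I_k -> X := fun j => if (j < n)%N then v j else w j.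
have -> : v = S k by apply/funext => j; rewrite /S ltn_ord.
have -> : w = S 0 by apply/funext => j.
rewrite -(telescope_sumr (fun n => M (S n))) // big_mkord.
apply: eq_bigr => i _.
have MB x y : M [eta S i with i |-> x] - M [eta S i with i |-> y] =
              M [eta S i with i |-> x - y].
  have /= := Mlin i (S i) (-1) y x.
  by rewrite !scaleN1r => E; rewrite [x - y]addrC E addrC.
have -> : S i.+1 = [eta S i with i |-> v i].
  apply/funext => j /=; rewrite /S ltnS leq_eqVlt -[nat_of_ord j == i]/(j == i).
  by case: eqP => [->|].
have {2}-> : S i = [eta S i with i |-> w i].
  by apply/funext => j /=; rewrite /S; case: eqP => [->|//]; rewrite ltnn.
rewrite MB; congr M; apply/funext => j; rewrite /gap /S /= ltn_ord /=.
by case: eqP => [->|]; case: ltnP; rewrite ?ltnn.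
Qed.

(** In each of the [k] telescoping terms one argument is [a - b] and the others
    lie in the unit ball. *)
Lemma diagonal_lipschitz a b : rnorm a <= 1 -> rnorm b <= 1 ->
  rnorm (M (fun=> a) - M (fun=> b)) <= k%:R * opnorm * rnorm (a - b).
Proof.
move=> a1 b1; rewrite multilinear_telescope.
apply: le_trans (rnorm_sum _ _) _.
have -> : k%:R * opnorm * rnorm (a - b) = \sum_(i < k) opnorm * rnorm (a - b).
  by rewrite sumr_const card_ord -mulrA mulr_natl.
apply: ler_sum => i _; apply: le_trans (le_opnorm _) _.
rewrite ler_wpM2l ?opnorm_ge0 // (bigD1 i) //= /gap ltnn eqxx.
rewrite ler_piMr ?rnorm_ge0 //; apply: Num.Theory.prodr_ile1 => j ji.
by rewrite rnorm_ge0 (negPf ji); case: ifP.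
Qed.

(** Telescoping twice: the [i]-th terms of the two first differences share the
    argument [y] in position [i] and differ by [u] in each other position.
    Exchanging position [i] contributes nothing, which leaves [k (k - 1)] terms
    with one argument [y], one argument [u] and the others in the unit ball. *)
Lemma diagonal_diff2 z y u :
  rnorm z <= 1 -> rnorm (z + y) <= 1 -> rnorm (z + u) <= 1 ->
  rnorm (z + u + y) <= 1 ->
  rnorm (M (fun=> z + u + y) - M (fun=> z + u)
         - (M (fun=> z + y) - M (fun=> z)))
    <= k%:R * (k%:R - 1) * opnorm * rnorm y * rnorm u.
Proof.
move=> z1 zy1 zu1 zuy1; rewrite !multilinear_telescope -sumrB.
apply: le_trans (rnorm_sum _ _) _.
have -> : k%:R * (k%:R - 1) * opnorm * rnorm y * rnorm u =
    \sum_(i < k) (k%:R - 1) * (opnorm * rnorm y * rnorm u).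
  by rewrite sumr_const card_ord -!mulrA mulr_natl.
apply: ler_sum => i _; rewrite multilinear_telescope.
apply: le_trans (rnorm_sum _ _) _.
rewrite (bigD1 i) //=.
set G := gap i (fun=> z + u + y) (fun=> z + u).
set H := gap i (fun=> z + y) (fun=> z).
have Gi : G i = y by rewrite /G /gap ltnn eqxx addrAC subrr add0r.
have Hi : H i = y by rewrite /H /gap ltnn eqxx addrAC subrr add0r.
have GHj j : j != i -> G j - H j = u.
  move=> ji; rewrite /G /H /gap (negPf ji); case: ifP => _.
    by rewrite opprD addrACA subrr addr0 addrAC subrr add0r.
  by rewrite addrAC subrr add0r.
(* All arguments other than the one in position [i] stay in the unit ball. *)
have G1 j : j != i -> rnorm (G j) <= 1.
  by move=> ji; rewrite /G /gap (negPf ji); case: ifP.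
have H1 j : j != i -> rnorm (H j) <= 1.
  by move=> ji; rewrite /H /gap (negPf ji); case: ifP.
have -> : rnorm (M (gap i G H)) = 0.
  apply/eqP; rewrite eq_le rnorm_ge0 andbT; apply: le_trans (le_opnorm _) _.
  have -> : \prod_j rnorm (gap i G H j) = 0; last by rewrite mulr0.
  by rewrite (bigD1 i) //= /gap ltnn eqxx Gi Hi subrr rnorm0 mul0r.
rewrite add0r.
have k0 : (0 < k)%N by exact: leq_ltn_trans (leq0n i) (ltn_ord i).
have -> : k%:R - 1 = (k.-1)%:R :> R by rewrite -{1}(prednK k0) -natr1 addrK.
have <- : #|[pred j | j != i]| = k.-1.
  by have := cardC1 i; rewrite card_ord => <-; apply: eq_card.
rewrite mulr_natl -sumr_const; apply: ler_sum => j ji.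
apply: le_trans (le_opnorm _) _; rewrite -mulrA ler_wpM2l ?opnorm_ge0 //.
rewrite (bigD1 i) //= (bigD1 j) //= mulrA.
have -> : gap j G H i = y.
  by rewrite /gap [i == j]eq_sym (negPf ji) Gi Hi; case: ifP.
have -> : gap j G H j = u by rewrite /gap ltnn eqxx GHj.
rewrite ler_piMr ?mulr_ge0 ?rnorm_ge0 //.
apply: Num.Theory.prodr_ile1 => l /andP[li lj].
by rewrite rnorm_ge0 /gap (negPf lj); case: ifP => _; [exact: G1|exact: H1].
Qed.

End MultilinearBounds.

(** * Limits and differentials in terms of the real-valued norm *)

Section LimitsAndDifferentials.
Context {R : realType} {X : normedModType R[i]}.

Lemma cvg_rnormP (u : nat -> X) (l : X) : u @ \oo --> l ->
  forall e : R, 0 < e -> \forall n \near \oo, rnorm (u n - l) < e.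
Proof.
move=> ul e e0.
have /ul : nbhs l [set y | rnorm (y - l) < e] by apply/nbhs_rnormP; exists e.
exact.
Qed.

Lemma rnorm_cvg_le (u : nat -> X) (l : X) (c : R) : u @ \oo --> l ->
  (forall n, rnorm (u n) <= c) -> rnorm l <= c.
Proof.
move=> ul uc; apply/ler_addgt0Pr => e e0.
have [n ne] := filter_ex (cvg_rnormP ul e0).
rewrite -(subrK (u n) l) (le_trans (ler_rnormD _ _)) // addrC lerD //.
by rewrite rdistC ltW.
Qed.

Lemma differentiable_rnorm (f : X -> X) z : differentiable f z ->
  forall e : R, 0 < e ->
    \forall h \near (0 : X), rnorm (f (z + h) - f z - 'd f z h) <= e * rnorm h.
Proof.
move=> df e e0; have /diff_locallyxP[_ fz] := df.
have e0' : 0 < e%:C :> R[i] by rewrite ltcR.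
have /eqaddoP lo : f \o shift z = (cst (f z) + 'd f z : X -> X) +o_ (0 : X) id.
  exact/funext.
apply: filterS (lo _ e0') => h.
rewrite rnormE (rnormE (id h)) -rmorphM lecR.
by rewrite (addrC z) /cst /shift /= opprD addrA.
Qed.

(** The differential is defined by a choice among linear maps; a candidate is
    recognised by linearity, boundedness and the first-order estimate. *)
Lemma rnorm_differentiable (f df : X -> X) z (c : R) : linear df ->
  (forall x, rnorm (df x) <= c * rnorm x) ->
  (forall e : R, 0 < e ->
    \forall h \near (0 : X), rnorm (f (z + h) - f z - df h) <= e * rnorm h) ->
  differentiable f z.
Proof.
move=> lin_df df_le approx.
pose L : {linear X -> X} := HB.pack df (GRing.isLinear.Build _ _ _ _ df lin_df).
have Lcont : continuous L.
  apply/linear_bounded_continuous/linear_boundedP; exists c%:C.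
  split=> [|M cM x]; first by rewrite complex_real.
  apply: le_trans (_ : c%:C * `|x| <= _); last by rewrite ler_wpM2r // ltW.
  by rewrite rnormE (rnormE x) -rmorphM lecR df_le.
have Lo : f \o shift z = cst (f z) + L +o_ (0 : X) id.
  apply/eqaddoP => e e0.
  have eE : e = (complex.Re e)%:C by rewrite RRe_real // ger0_real // ltW.
  have e0' : 0 < complex.Re e by rewrite -(@ltcR R) -eE.
  apply: filterS (approx _ e0') => h hle.
  rewrite eE rnormE (rnormE (id h)) -rmorphM lecR.
  move: hle; rewrite (addrC z) /cst /shift /= opprD addrA; exact.
by apply/diff_locallyP; rewrite (diff_unique Lcont Lo).
Qed.

End LimitsAndDifferentials.

(** * Contractive perturbations of the identity *)

Section PerturbationOfIdentity.
Context {R : realType} {X : completeNormedModType R[i]}.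

(** Solving [w + h w = y] amounts to finding a fixed point of
    [g w = y - h w], a [q]-contraction; the assumption on [y] is what makes [g]
    preserve the closed ball of centre [a] and radius [r].  The
    fixed point is the limit of the iterates of [g] from [a]. *)
Lemma perturbation_onto (h : X -> X) (q r : R) (a y : X) :
  0 <= q -> q < 1 ->
  (forall u v, rnorm (u - a) <= r -> rnorm (v - a) <= r ->
     rnorm (h u - h v) <= q * rnorm (u - v)) ->
  rnorm (y - (a + h a)) <= (1 - q) * r ->
  exists2 w, rnorm (w - a) <= r & w + h w = y.
Proof.
move=> q0 q1 hlip yr.
have r0 : 0 <= r.
  rewrite -(pmulr_rge0 _ (_ : 0 < 1 - q)) ?subr_gt0 //.
  by rewrite (le_trans _ yr) ?rnorm_ge0.
pose g w := y - h w.
have gB u v : g u - g v = - (h u - h v).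
  by rewrite /g opprD addrACA subrr add0r opprD.
have gr w : rnorm (w - a) <= r -> rnorm (g w - a) <= r.
  move=> wr; have -> : g w - a = (y - (a + h a)) + (h a - h w).
    by rewrite /g opprD !addrA subrK addrAC.
  rewrite (le_trans (ler_rnormD _ _)) //.
  have -> : r = (1 - q) * r + q * r by rewrite -mulrDl subrK mul1r.
  rewrite lerD // (le_trans (hlip _ _ _ _)) ?subrr ?rnorm0 //.
  by rewrite ler_wpM2l // rdistC.
pose x n := iter n g a.
have xr n : rnorm (x n - a) <= r.
  by elim: n => [|n IH]; rewrite ?subrr ?rnorm0 //= gr.
(* The [n]-th iterate contracts the distance between [x p] and [a] by
   [q ^+ n], which gives the Cauchy property without summing a geometric
   series. *)
have xc n p : rnorm (x (n + p)%N - x n) <= q ^+ n * r.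
  elim: n => [|n IH]; first by rewrite expr0 mul1r.
  rewrite addSn /= gB rnormN (le_trans (hlip _ _ _ _)) // exprS -mulrA.
  by rewrite ler_wpM2l.
have qr (e : R) : 0 < e -> \forall n \near \oo, q ^+ n * r < e.
  move=> e0; have qn : q ^+ n * r @[n --> \oo] --> 0.
    rewrite -[0](mul0r r); apply: cvgMl; apply: cvg_expr.
    by rewrite ger0_norm.
  have := cvgr_lt _ qn _ e0; exact.
have /cauchy_cvgP xl : cauchy (x @ \oo).
  apply: cauchy_exP => e e0.
  have eE : e = (complex.Re e)%:C by rewrite RRe_real // ger0_real // ltW.
  have e0' : 0 < complex.Re e by rewrite -(@ltcR R) -eE.
  have [n nq] := filter_ex (qr _ e0').
  exists (x n); exists n => // m /= nm.
  rewrite -ball_normE /ball_ /= eE distrC lt_rnorm.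
  by rewrite -(subnKC nm) (le_lt_trans (xc _ _)).
pose w := lim (x @ \oo).
have {xl} xw : x @ \oo --> w by [].
have wr : rnorm (w - a) <= r.
  apply: (@rnorm_cvg_le _ _ (fun n => x n - a)) => //.
  by apply: cvgB => //; exact: cvg_cst.
exists w => //; apply/eqP; rewrite eq_sym -subr_eq -subr_eq0 -rnorm_eq0.
rewrite eq_le rnorm_ge0 andbT; apply/ler_addgt0Pr => e e0; rewrite add0r.
have e20 : 0 < e / 2 by rewrite divr_gt0.
have [n [wn wn1]] : exists n, rnorm (x n - w) < e / 2 /\
    rnorm (x n.+1 - w) < e / 2.
  have xw1 : x n.+1 @[n --> \oo] --> w by rewrite cvg_shiftS.
  exact: (filter_ex (filterI (cvg_rnormP xw e20) (cvg_rnormP xw1 e20))).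
rewrite (le_trans (ler_rdistD (x n.+1) _ _)) // [leRHS]splitr.
rewrite lerD ?(ltW wn1) //.
rewrite -/(g w) /= gB rnormN (le_trans (hlip _ _ _ _)) // rdistC.
by rewrite (le_trans _ (ltW wn)) // ler_piMl ?rnorm_ge0 // ltW.
Qed.

End PerturbationOfIdentity.

Section ContractivePerturbation.
Context {R : realType} {X : completeNormedModType R[i]}.
Variables (f : X -> X) (q : R).
Hypotheses (f_holo : holomorphic unit_ball f) (q0 : 0 <= q) (q1 : q < 1).
Hypothesis f_lip : forall u v, rnorm u < 1 -> rnorm v < 1 ->
  rnorm ((f u - u) - (f v - v)) <= q * rnorm (u - v).

Let oq0 : 0 < 1 - q. Proof. by rewrite subr_gt0. Qed.

Lemma near_unit_ball z : rnorm z < 1 ->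
  \forall h \near (0 : X), rnorm (z + h) < 1.
Proof.
move=> z1; apply/nbhs0_rnormP; exists (1 - rnorm z); first by rewrite subr_gt0.
by move=> y yz; rewrite (le_lt_trans (ler_rnormD _ _)) // -ltrBrDl.
Qed.

Lemma diff_sub_id_le z y : rnorm z < 1 -> rnorm ('d f z y - y) <= q * rnorm y.
Proof.
move=> z1; have df : differentiable f z by apply: f_holo; rewrite unit_ballE.
move: y; apply: (@homogeneous_bound _ _ (fun y => 'd f z y - y)) => [t h|e e0].
  by rewrite linearZ /= scalerBr.
apply: filterS2 (near_unit_ball z1) (differentiable_rnorm df e0) => h zh dfe.
have -> : 'd f z h - h = ((f (z + h) - (z + h)) - (f z - z))
                         - (f (z + h) - f z - 'd f z h).
  rewrite (subrACA (f _)) [z + h - z]addrC addrA addNr add0r.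
  by rewrite (subrACA (f _ - _)) subrr sub0r opprB.
rewrite (le_trans (ler_rnormB _ _)) // mulrDl lerD //.
by rewrite (le_trans (f_lip _ _)) // addrAC subrr add0r.
Qed.

Lemma diff_expand z y : rnorm z < 1 -> (1 - q) * rnorm y <= rnorm ('d f z y).
Proof.
move=> /(diff_sub_id_le y) H; rewrite mulrBl mul1r lerBlDr.
rewrite (le_trans _ (lerD (lexx _) H)) //.
have {1}-> : y = 'd f z y - ('d f z y - y) by rewrite subKr.
exact: ler_rnormB.
Qed.

(** [perturbation_onto] around [0] for the linear contraction ['d f z - id]; the
    radius is the smallest one for which the lemma reaches [y]. *)
Lemma diff_surj z y : rnorm z < 1 -> exists x, 'd f z x = y.
Proof.
move=> z1.
pose r := rnorm y / (1 - q).
have := @perturbation_onto _ X (fun x => 'd f z x - x) q r 0 y q0 q1.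
case=> [u v _ _||w _ wy].
- by rewrite subrACA -linearB diff_sub_id_le.
- by rewrite linear0 subrr addr0 subr0 mulrC /r divfK ?gt_eqF.
- by exists w; rewrite -wy addrC subrK.
Qed.

Lemma diff_invK z y : rnorm z < 1 -> 'd f z (diff_inv f z y) = y.
Proof.
move=> z1; rewrite /diff_inv pinvK // inE.
by have [x <-] := diff_surj y z1; exists x.
Qed.

Lemma diff_inv_le z y : rnorm z < 1 ->
  rnorm (diff_inv f z y) <= (1 - q)^-1 * rnorm y.
Proof.
move=> z1; rewrite ler_pdivlMl //.
by rewrite -{2}(diff_invK y z1) diff_expand.
Qed.

Lemma diff_injective z : rnorm z < 1 -> injective ('d f z).
Proof.
move=> z1 u v uv; apply/eqP; rewrite -subr_eq0 -rnorm_eq0 eq_le rnorm_ge0 andbT.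
rewrite -(pmulr_rle0 _ oq0) (le_trans (diff_expand _ z1)) //.
by rewrite linearB /= uv subrr rnorm0.
Qed.

Lemma diff_inv_linear z : rnorm z < 1 -> linear (diff_inv f z).
Proof.
move=> z1 a u v; apply: (diff_injective z1).
by rewrite linearP /= !diff_invK.
Qed.

Lemma expand_unit_ball u v : rnorm u < 1 -> rnorm v < 1 ->
  (1 - q) * rnorm (u - v) <= rnorm (f u - f v).
Proof.
move=> u1 v1; rewrite mulrBl mul1r lerBlDr.
rewrite (le_trans _ (lerD (lexx _) (f_lip u1 v1))) //.
have {1}-> : u - v = (f u - f v) - ((f u - u) - (f v - v)).
  by rewrite (subrACA (f u) u) subKr.
exact: ler_rnormB.
Qed.

Lemma inj_unit_ball : {in unit_ball &, injective f}.
Proof.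
move=> u v; rewrite !inE !unit_ballE => u1 v1 uv; apply/eqP.
rewrite -subr_eq0 -rnorm_eq0 eq_le rnorm_ge0 andbT -(pmulr_rle0 _ oq0).
by rewrite (le_trans (expand_unit_ball u1 v1)) // uv subrr rnorm0.
Qed.

(** The radius [r] keeps the closed ball of centre [a] inside the open unit
    ball, where [f - id] is a contraction. *)
Lemma image_unit_ball a : rnorm a < 1 ->
  \forall k \near (0 : X), exists2 w, rnorm w < 1 & f w = f a + k.
Proof.
move=> a1; pose r := (1 - rnorm a) / 2.
have r0 : 0 < r by rewrite divr_gt0 // subr_gt0.
apply/nbhs0_rnormP; exists ((1 - q) * r); first by rewrite mulr_gt0.
move=> k kr.
have wB w : rnorm (w - a) <= r -> rnorm w < 1.
  move=> wr; rewrite -(subrK a w) (le_lt_trans (ler_rnormD _ _)) //.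
  rewrite -ltrBrDr (le_lt_trans wr) // ltr_pdivrMr //.
  by rewrite ltr_pMr ?ltr1n ?subr_gt0.
have := @perturbation_onto _ X (fun x => f x - x) q r a (f a + k) q0 q1.
case=> [u v /wB u1 /wB v1||w /wB w1 wy]; first exact: f_lip.
  by rewrite [a + _]addrC subrK (addrC (f a)) addrK ltW.
by exists w => //; rewrite -wy addrC subrK.
Qed.

(** Put [w = g (f a + k)], so that [k = f w - f a].  The first-order remainder
    of [f] at [a] is [o(w - a)], hence [o(k)] because [f] shrinks distances by
    a factor [1 - q] at most; applying [Df(a)^-1], bounded by [1 / (1 - q)],
    turns it into the first-order remainder of [g].  These two factors explain
    [(1 - q) ^+ 2] in the proof. *)
Lemma inverse_differentiable a : rnorm a < 1 ->
  differentiable ('pinv_(fun=> 0) unit_ball f) (f a).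
Proof.
move=> a1; set g := 'pinv_(_) _ _.
have df : differentiable f a by apply: f_holo; rewrite unit_ballE.
have gK w : rnorm w < 1 -> g (f w) = w.
  by move=> w1; rewrite /g pinvKV ?inE ?unit_ballE //; exact: inj_unit_ball.
apply: (rnorm_differentiable (diff_inv_linear a1) (fun y => diff_inv_le y a1)).
move=> e e0.
pose d := e * (1 - q) ^+ 2.
have d0 : 0 < d by rewrite mulr_gt0 // exprn_gt0.
have /nbhs0_rnormP[r r0 fr] := differentiable_rnorm df d0.
have [s s0 imf] := (nbhs0_rnormP _).1 (image_unit_ball a1).
apply/nbhs0_rnormP; exists (Num.min s ((1 - q) * r)).
  by rewrite lt_min s0 mulr_gt0.
move=> k; rewrite lt_min => /andP[/imf[w w1 fw] kr].
rewrite -fw !gK //.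
have wk : (1 - q) * rnorm (w - a) <= rnorm k.
  by rewrite (le_trans (expand_unit_ball w1 a1)) // fw addrC addKr.
have {kr} /fr : rnorm (w - a) < r by rewrite -(ltr_pM2l oq0) (le_lt_trans wk).
rewrite [a + _]addrC subrK fw [f a + k]addrC addrK => kw.
have -> : w - a - diff_inv f a k = - diff_inv f a (k - 'd f a (w - a)).
  apply: (diff_injective a1).
  by rewrite linearN /= diff_invK // linearB /= diff_invK // opprB.
rewrite rnormN (le_trans (diff_inv_le _ a1)) // ler_pdivrMl //.
rewrite (le_trans kw) //.
have -> : d * rnorm (w - a) = (1 - q) * (e * ((1 - q) * rnorm (w - a))).
  by rewrite /d; ring.
by rewrite !ler_pM2l.
Qed.

(** The unit ball itself serves as the neighbourhood of each of its points. *)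
Lemma contractive_locally_biholomorphic : locally_biholomorphic unit_ball f.
Proof.
have ob : open (unit_ball : set X).
  rewrite openE => z; rewrite unit_ballE => z1; apply/nbhs_rnormP.
  have /nbhs0_rnormP[r r0 zr] := near_unit_ball z1; exists r => // y /zr.
  by rewrite addrC subrK unit_ballE.
move=> z z1; exists unit_ball; split=> //; split=> //.
  rewrite openE => _ [a +] <-; rewrite unit_ballE => a1; apply/nbhs_rnormP.
  have /nbhs0_rnormP[r r0 fr] := image_unit_ball a1; exists r => // y /fr[w w1].
  by rewrite addrC subrK => <-; exists w => //; rewrite unit_ballE.
exists ('pinv_(fun=> 0) unit_ball f).
  by move=> _ [a +] <-; rewrite unit_ballE; exact: inverse_differentiable.
by move=> w w1; rewrite pinvKV ?inE //; exact: inj_unit_ball.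
Qed.

End ContractivePerturbation.

(** * Bounds on the second derivative *)

Section SecondDerivative.
Context {R : realType} {X : completeNormedModType R[i]}.
Variables (f : X -> X) (s : R).
Hypotheses (f_holo : holomorphic unit_ball f) (s0 : 0 <= s).
Hypothesis f_diff2 : forall z y u, rnorm z < 1 -> rnorm (z + y) < 1 ->
  rnorm (z + u) < 1 -> rnorm (z + u + y) < 1 ->
  rnorm (f (z + u + y) - f (z + u) - (f (z + y) - f z))
    <= s * rnorm y * rnorm u.

(** The second difference is, up to first-order remainders in [y], the
    increment of ['d f] between [z] and [z + u] applied to [y]. *)
Lemma diff_lipschitz z u y : rnorm z < 1 -> rnorm (z + u) < 1 ->
  rnorm ('d f (z + u) y - 'd f z y) <= s * rnorm u * rnorm y.
Proof.
move=> z1 zu1.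
have dz : differentiable f z by apply: f_holo; rewrite unit_ballE.
have dzu : differentiable f (z + u) by apply: f_holo; rewrite unit_ballE.
move: y; apply: (@homogeneous_bound _ _ (fun y => 'd f (z + u) y - 'd f z y)).
  by move=> t h; rewrite linearZ linearZ /= scalerBr; reflexivity.
move=> e e0; have e20 : 0 < e / 2 by rewrite divr_gt0.
have d1 := differentiable_rnorm dz e20.
have d2 := differentiable_rnorm dzu e20.
apply: filterS2 (filterI (near_unit_ball z1) (near_unit_ball zu1))
  (filterI d1 d2) => h [zh1 zuh1] [d1h d2h].
have -> : 'd f (z + u) h - 'd f z h =
    (f (z + u + h) - f (z + u) - (f (z + h) - f z))
    - ((f (z + u + h) - f (z + u) - 'd f (z + u) h)
       - (f (z + h) - f z - 'd f z h)).
  by rewrite [in RHS](subrACA _ ('d f (z + u) h)) subKr.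
rewrite (le_trans (ler_rnormB _ _)) // mulrDl lerD //.
  by rewrite mulrAC f_diff2.
rewrite (le_trans (ler_rnormB _ _)) // [e in leRHS]splitr mulrDl.
by rewrite lerD.
Qed.

(** [T] is the derivative of the Lipschitz map ['d f], with the vector [x] to
    which ['d f] is applied kept fixed. *)
Lemma fderiv2_le z T x : rnorm z < 1 -> is_fderiv (fderivn 1 f) z T ->
  rnorm (T (fun=> x)) <= s * rnorm x ^+ 2.
Proof.
move=> z1 [[Tlin _] dT].
have Tl := vcons_linear (fun=> x) Tlin.
pose L : {linear X -> X} :=
  HB.pack (fun h => T (vcons h (fun=> x))) (GRing.isLinear.Build _ _ _ _ _ Tl).
have -> : (fun=> x) = vcons x (fun=> x) :> ('I_2 -> X).
  by rewrite -[LHS]vconsK.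
rewrite expr2 mulrA; apply: (@homogeneous_bound _ _ L _ _ _ x).
  by move=> t h; rewrite linearZ.
move=> e e0.
have x0 : 0 < rnorm x + 1 by rewrite ltr_wpDl ?rnorm_ge0.
have e'0 : 0 < e / (rnorm x + 1) by rewrite divr_gt0.
apply: filterS2 (near_unit_ball z1) (dT _ e'0) => h zh1 /(_ (fun=> x)).
rewrite big_ord1 !fderivn1; try by apply: f_holo; rewrite unit_ballE.
rewrite rnormE (rnormE h) (rnormE x) -!rmorphM lecR => Th.
have -> : L h = ('d f (z + h) x - 'd f z x)
                - ('d f (z + h) x - 'd f z x - L h) by rewrite subKr.
rewrite (le_trans (ler_rnormB _ _)) // mulrDl lerD //.
  by rewrite mulrAC diff_lipschitz.
rewrite (le_trans Th) // mulrAC ler_wpM2r ?rnorm_ge0 // mulrAC.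
by rewrite ler_pdivrMr // ler_pM2l // lerDl.
Qed.

(** Either [fderivn 2 f z] is a derivative of ['d f] at [z], and [fderiv2_le]
    applies, or it is the default value [0]. *)
Lemma fderivn2_le z x : rnorm z < 1 ->
  rnorm (fderivn 2 f z (fun=> x)) <= s * rnorm x ^+ 2.
Proof.
move=> z1.
rewrite -[fderivn 2 f z]/(xget (fun=> 0) [set T | is_fderiv (fderivn 1 f) z T]).
case: xgetP => [T _ /fderiv2_le|_]; first exact.
by rewrite rnorm0 mulr_ge0 // exprn_ge0 // rnorm_ge0.
Qed.

End SecondDerivative.

(** * The coefficients *)

(** The supremum [q] of the partial sums of [k a_k] stands for the sum of the
    series.  The second bound compares a partial sum of [k (k - 1) a_k] with
    one of [k a_k] of a different length: both grow with the length, so the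
    longer of the two lengths serves for both. *)
Lemma coef_bounds {R : realType} (alpha : R) (a : nat -> R) : alpha < 1 ->
  (forall k, 0 <= a k) ->
  (forall n, \sum_(2 <= k < n) k%:R * (k%:R - alpha) * a k <= 1 - alpha) ->
  exists q : R, [/\ 0 <= q, q < 1,
    forall n, \sum_(2 <= k < n) k%:R * a k <= q &
    forall n,
      \sum_(2 <= k < n) k%:R * (k%:R - 1) * a k <= (1 - alpha) * (1 - q)].
Proof.
move=> al1 a0 Ha.
pose Q n := \sum_(2 <= k < n) k%:R * a k.
pose P n := \sum_(2 <= k < n) k%:R * (k%:R - 1) * a k.
have oal : 0 < 1 - alpha by rewrite subr_gt0.
have tal : 0 < 2 - alpha by lra.
have PQ n : P n + (1 - alpha) * Q n <= 1 - alpha.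
  rewrite (le_trans _ (Ha n)) // /P /Q mulr_sumr -big_split /=.
  by apply: ler_sum => k _; rewrite le_eqVlt; apply/orP; left; apply/eqP; ring.
have Q1 n : Q n <= (1 - alpha) / (2 - alpha).
  rewrite ler_pdivlMr // (le_trans _ (Ha n)) // /Q mulr_suml.
  rewrite !big_nat; apply: ler_sum => k /andP[k2 _].
  rewrite mulrAC ler_wpM2r // ler_wpM2l //.
  by rewrite lerD2r ler_nat.
have mono (F : nat -> R) : (forall k, (2 <= k)%N -> 0 <= F k) ->
    forall m n, (m <= n)%N -> \sum_(2 <= k < m) F k <= \sum_(2 <= k < n) F k.
  move=> F0 m n mn; have [m2|m2] := leqP m 2.
    by rewrite big_geq // big_nat sumr_ge0 // => k /andP[k2 _]; exact: F0.
  rewrite [leRHS](big_cat_nat (n := m)) //=; last exact: ltnW.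
  rewrite lerDl big_nat sumr_ge0 // => k /andP[mk _].
  by rewrite F0 // (leq_trans _ mk) // ltnW.
have Pmono : forall m n, (m <= n)%N -> P m <= P n.
  apply: mono => k k2.
  by rewrite !mulr_ge0 // subr_ge0 (ler_nat _ 1) (leq_trans _ k2).
have Qmono : forall m n, (m <= n)%N -> Q m <= Q n.
  by apply: mono => k _; rewrite mulr_ge0.
have Qub : has_ubound (range Q).
  by exists ((1 - alpha) / (2 - alpha)) => _ [n _ <-].
have Qsup n : Q n <= sup (range Q) by apply: ub_le_sup => //; exists n.
have Q0 : range Q !=set0 by exists (Q 0), 0.
exists (sup (range Q)); split => //.
- by rewrite (le_trans _ (Qsup 0)) // /Q big_geq.
- apply: (@le_lt_trans _ _ ((1 - alpha) / (2 - alpha))).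
    by apply: ge_sup => // _ [n _ <-].
  by rewrite ltr_pdivrMr // mul1r; lra.
- move=> n; have : sup (range Q) <= 1 - P n / (1 - alpha).
    apply: ge_sup => // _ [m _ <-].
    rewrite lerBrDr -(ler_pM2l oal) mulrDr mulr1 [_ * (_ / _)]mulrCA.
    rewrite divff ?gt_eqF // mulr1 addrC.
    apply: le_trans (PQ (maxn m n)).
    by rewrite lerD ?Pmono ?leq_maxr // ler_pM2l // Qmono ?leq_maxl.
  move=> H; rewrite -/(P n) -ler_pdivrMl // mulrC; lra.
Qed.

(** * Maps given by a power series *)

Section PowerSeries.
Context {R : realType} {X : completeNormedModType R[i]}.
Variables (f : X -> X) (A : forall k, ('I_k -> X) -> X).
Arguments A : clear implicits.
Hypothesis A_bounded : forall k, (2 <= k)%N -> bounded_multilinear (A k).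
Hypothesis f_series : forall z : X, unit_ball z ->
  (fun n : nat => z + \sum_(2 <= k < n) A k (fun=> z)) @ \oo --> f z.
Variable q : R.
Hypothesis A_q : forall n, \sum_(2 <= k < n) k%:R * opnorm (A k) <= q.

Lemma series_cvg z : rnorm z < 1 ->
  (fun n : nat => \sum_(2 <= k < n) A k (fun=> z)) @ \oo --> f z - z.
Proof.
rewrite -unit_ballE => /f_series fz.
rewrite (_ : (fun n => _) = (fun n => z + \sum_(2 <= k < n) A k (fun=> z) - z)).
  by apply: cvgB => //; exact: cvg_cst.
by apply/funext => n; rewrite addrAC subrr add0r.
Qed.

Lemma series_sub_id_lipschitz u v : rnorm u < 1 -> rnorm v < 1 ->
  rnorm ((f u - u) - (f v - v)) <= q * rnorm (u - v).
Proof.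
move=> u1 v1.
apply: (rnorm_cvg_le (cvgB (series_cvg u1) (series_cvg v1))) => n.
rewrite !fctE -sumrB.
apply: (@le_trans _ _
  ((\sum_(2 <= k < n) k%:R * opnorm (A k)) * rnorm (u - v))).
  rewrite mulr_suml (le_trans (rnorm_sum _ _)) // !big_nat.
  apply: ler_sum => k /andP[k2 _].
  by apply: (diagonal_lipschitz (A_bounded k2)); exact: ltW.
by rewrite ler_wpM2r ?rnorm_ge0.
Qed.

(** Every term has degree at least [2], and [m_k <= k m_k]. *)
Lemma series_sub_id_quadratic z : rnorm z < 1 ->
  rnorm (f z - z) <= q * rnorm z ^+ 2.
Proof.
move=> z1; apply: (rnorm_cvg_le (series_cvg z1)) => n.
apply: (@le_trans _ _ ((\sum_(2 <= k < n) k%:R * opnorm (A k)) * rnorm z ^+ 2)).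
  rewrite mulr_suml (le_trans (rnorm_sum _ _)) // !big_nat.
  apply: ler_sum => k /andP[k2 _].
  rewrite (le_trans (le_opnorm (A_bounded k2) _)) // prodr_const card_ord.
  have o0 := opnorm_ge0 (A k).
  apply: ler_pM => //; first by rewrite exprn_ge0 ?rnorm_ge0.
    by rewrite ler_peMl // (ler_nat _ 1) (leq_trans _ k2).
  by rewrite ler_wiXn2l ?rnorm_ge0 // ltW.
by rewrite ler_wpM2r // exprn_ge0 ?rnorm_ge0.
Qed.

Lemma series_at0 : f 0 = 0.
Proof.
have := @series_sub_id_quadratic 0; rewrite rnorm0 expr0n mulr0 subr0 => H.
by apply/eqP; rewrite -rnorm_eq0 eq_le rnorm_ge0 H.
Qed.

Lemma series_diff0 x : differentiable f 0 -> 'd f 0 x = x.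
Proof.
move=> df; apply/eqP; rewrite -subr_eq0 -rnorm_eq0 eq_le rnorm_ge0 andbT.
rewrite -(mul0r (rnorm x)).
apply: (@homogeneous_bound _ _ (fun x => 'd f 0 x - x)) => [t h|e e0].
  by rewrite linearZ /= scalerBr.
have e20 : 0 < e / 2 by rewrite divr_gt0.
have q0 : 0 <= q by rewrite (le_trans _ (A_q 0)) // big_geq.
have q1 : 0 < q + 1 by rewrite ltr_wpDl.
have small : \forall h \near (0 : X), rnorm h < Num.min 1 (e / 2 / (q + 1)).
  apply/nbhs0_rnormP; eexists; last by move=> y; exact.
  by rewrite lt_min ltr01 divr_gt0.
apply: filterS2 small (differentiable_rnorm df e20) => h.
rewrite lt_min => /andP[h1 he]; rewrite add0r series_at0 subr0 => dh.
have -> : 'd f 0 h - h = (f h - h) - (f h - 'd f 0 h).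
  by rewrite subrACA subrr sub0r opprB.
rewrite (le_trans (ler_rnormB _ _)) // add0r [e in leRHS]splitr mulrDl lerD //.
rewrite (le_trans (series_sub_id_quadratic h1)) // expr2 mulrA.
rewrite ler_wpM2r ?rnorm_ge0 //.
move: he; rewrite ltr_pdivlMr // => he; rewrite (le_trans _ (ltW he)) //.
by rewrite mulrC ler_wpM2l ?rnorm_ge0 // lerDl.
Qed.

(** The identity has zero second difference, so the left-hand side is the
    second difference of [f - id], the sum of the series. *)
Lemma series_diff2 s z y u :
  (forall n, \sum_(2 <= k < n) k%:R * (k%:R - 1) * opnorm (A k) <= s) ->
  rnorm z < 1 -> rnorm (z + y) < 1 -> rnorm (z + u) < 1 ->
  rnorm (z + u + y) < 1 ->
  rnorm (f (z + u + y) - f (z + u) - (f (z + y) - f z))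
    <= s * rnorm y * rnorm u.
Proof.
move=> A_s z1 zy1 zu1 zuy1.
have -> : f (z + u + y) - f (z + u) - (f (z + y) - f z) =
    f (z + u + y) - (z + u + y) - (f (z + u) - (z + u))
    - (f (z + y) - (z + y) - (f z - z)).
  rewrite [in RHS](subrACA (f (z + u + y)) (z + u + y)).
  rewrite [in RHS](subrACA (f (z + y)) (z + y)).
  rewrite ![_ + y]addrC !addrK.
  by rewrite [in RHS](subrACA _ y) subrr subr0.
have := rnorm_cvg_le (cvgB (cvgB (series_cvg zuy1) (series_cvg zu1))
                        (cvgB (series_cvg zy1) (series_cvg z1))).
apply=> n.
rewrite !fctE -!sumrB.
apply: (@le_trans _ _ ((\sum_(2 <= k < n) k%:R * (k%:R - 1) * opnorm (A k))
                       * rnorm y * rnorm u)).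
  rewrite !mulr_suml (le_trans (rnorm_sum _ _)) // !big_nat.
  apply: ler_sum => k /andP[k2 _].
  by apply: (diagonal_diff2 (A_bounded k2)); exact: ltW.
by rewrite !ler_wpM2r ?rnorm_ge0.
Qed.

End PowerSeries.

(** * The Cauchy-Schwarz inequality and the convexity inequality *)

Section CauchySchwarz.
Context {R : realType} {X : completeNormedModType R[i]}.
Variable (ip : {dot X for Num.conj}).
Hypothesis hilbertX : is_hilbert ip.

Lemma rnorm_ip x : ip x x = (rnorm x ^+ 2)%:C.
Proof. by rewrite -hilbertX rnormE rmorphXn. Qed.

(** [norm (b u - a v) ^ 2 >= 0] for [a = norm u] and [b = norm v], expanded. *)
Lemma ip_le_rnorm u v : complex.Re (ip u v) <= rnorm u * rnorm v.
Proof.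
have [->|u0] := eqVneq u 0; first by rewrite linear0l rnorm0 mul0r.
have [->|v0] := eqVneq v 0; first by rewrite linear0r rnorm0 mulr0.
have a0 : 0 < rnorm u by rewrite rnorm_gt0.
have b0 : 0 < rnorm v by rewrite rnorm_gt0.
set a := rnorm u in a0 *; set b := rnorm v in b0 *.
pose p := b%:C *: u; pose r := a%:C *: v.
have dE : ip p r = (a * b)%:C * ip u v.
  rewrite linearZl_LR linearZr_LR /= mulrA conj_Creal ?complex_real //.
  by rewrite -rmorphM [b * a]mulrC.
have pn : rnorm p = a * b by rewrite rnormZR gtr0_norm // mulrC.
have rn : rnorm r = a * b by rewrite rnormZR gtr0_norm.
have /(congr1 (@complex.Re R)) := dnormB ip p r.
rewrite !rnorm_ip dE pn rn; case: (ip u v) => c d; simpc => /= H.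
have := sqr_ge0 (rnorm (p - r)); rewrite H => H0.
have {}H0 : 0 <= 2 * (a * b) * (a * b - c) by move: H0; congr (_ <= _); ring.
by rewrite -subr_ge0 -(pmulr_rge0 _ (_ : 0 < 2 * (a * b))) // !mulr_gt0.
Qed.

End CauchySchwarz.

Theorem theorem2 (R : realType) (X : completeNormedModType R[i])
    (ip : {dot X for Num.conj}) (hilbertX : is_hilbert ip)
    (alpha : R) (alpha_ge0 : 0 <= alpha) (alpha_lt1 : alpha < 1)
    (f : X -> X) (f_holo : holomorphic unit_ball f)
    (A : forall k : nat, ('I_k -> X) -> X)
    (A_bounded : forall k, (2 <= k)%N -> bounded_multilinear (A k))
    (A_sym : forall k, (2 <= k)%N -> symmetric_multilinear (A k))
    (A_deriv : forall k, (2 <= k)%N ->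
       forall v, A k v = (k`!%:R)^-1 *: fderivn k f 0 v)
    (f_series : forall z : X, unit_ball z ->
       (fun n : nat => z + \sum_(2 <= k < n) A k (fun=> z)) @ \oo --> f z)
    (A_sum : (\sum_(2 <= k <oo) (k%:R * (k%:R - alpha))%:E * mnorm (A k)
              <= (1 - alpha)%:E)%E) :
  convex_class ip alpha f.
Proof.
have Ha n : \sum_(2 <= k < n) k%:R * (k%:R - alpha) * opnorm (A k) <= 1 - alpha.
  rewrite -lee_fin (le_trans _ A_sum) //.
  apply: le_trans (nneseries_lim_ge n _); last first.
    move=> k k2 _; rewrite mule_ge0 ?mnorm_ge0 // lee_fin mulr_ge0 // subr_ge0.
    by rewrite (le_trans (ltW alpha_lt1)) // (ler_nat _ 1) (leq_trans _ k2).
  rewrite -sumEFin big_nat [leRHS]big_nat; apply: lee_sum => k /andP[k2 _].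
  by rewrite (mnormE (A_bounded _ k2)) -EFinM.
have [q [q0 q1 A_q A_s]] :=
  coef_bounds alpha_lt1 (fun k => opnorm_ge0 (A k)) Ha.
set s := (1 - alpha) * (1 - q) in A_s.
have s0 : 0 <= s by rewrite (le_trans _ (A_s 0)) // big_geq.
have f_lip := series_sub_id_lipschitz A_bounded f_series A_q.
split=> //; last 2 first.
- exact: (series_at0 A_bounded f_series A_q).
- move=> x; apply: (series_diff0 A_bounded f_series A_q).
  by apply: f_holo; rewrite unit_ballE rnorm0.
split; first exact: (contractive_locally_biholomorphic f_holo q0 q1 f_lip).
move=> z x; rewrite unit_ballE => z1 z0 x0 _.
set w := diff_inv f z _.
have x20 : 0 < rnorm x ^+ 2 by rewrite exprn_gt0 // rnorm_gt0.
have wle : rnorm w <= (1 - alpha) * rnorm x ^+ 2.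
  rewrite (le_trans (diff_inv_le f_holo q0 q1 f_lip _ z1)) //.
  rewrite ler_pdivrMl ?subr_gt0 // mulrA [(1 - q) * _]mulrC.
  apply: (fderivn2_le f_holo s0) => // u y v *.
  exact: (series_diff2 A_bounded f_series).
have : complex.Re (ip w z) < (1 - alpha) * rnorm x ^+ 2.
  apply: le_lt_trans (ip_le_rnorm hilbertX w z) _.
  apply: (@le_lt_trans _ _ ((1 - alpha) * rnorm x ^+ 2 * rnorm z)).
    by rewrite ler_wpM2r ?rnorm_ge0.
  by rewrite gtr_pMr // mulr_gt0 // subr_gt0.
by rewrite mulrBl mul1r => H; lra.
Qed.
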